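(* Let $n \geq 2$ and let $\{X(h)\}_{h}$ be independent random variables indexed by the edges $h$ of the complete graph $K_n$ on vertex set $\{1,2,\ldots,n\}$, with $\mathbb{P}(X(h)=1) = p(h) = 1-\mathbb{P}(X(h)=0)$; for an edge $h$ with endvertices $u,v$ write $p(u,v)=p(v,u)=p(h)$. Let $G$ be the random graph on $\{1,\ldots,n\}$ whose edges are those $h$ with $X(h)=1$. Define \[\alpha_{low}(n) := \min_{u} \frac{1}{n-1}\sum_{v \neq u} p(u,v),\qquad \alpha_{up}(n) := \max_{u} \frac{1}{n-1}\sum_{v \neq u} p(u,v),\qquad \alpha_e(n) := \binom{n}{2}^{-1}\sum_{1 \leq u<v\leq n} p(u,v).\] Suppose that \[\frac{1}{n^{\beta}} \leq \alpha_{low}(n) \leq \alpha_{up}(n) \leq \max\left(\frac{1}{2},\, 1-\sqrt{\frac{\alpha_e(n)}{2}}\right) - \frac{1}{n^{\gamma}}\] for some constants $0<\beta<\frac{1}{2}$ and $0<\gamma<\frac{1}{2}-\beta$. Then \[\mathbb{P}\left(N_{ext}(G) \leq 3t(G)\right) \geq 1 - e^{-D(\log n)^2} - \mathbb{P}(E_{disc})\] for some constant $D>0$, where $E_{disc}$ is the event that $G$ is disconnected.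
   Context: A graph is Eulerian if it has a closed walk (circuit) using every edge exactly once. A graph $G$ is Eulerian extendable if it can be made Eulerian by adding edges of its complement $\overline{G}$ (pairs of distinct vertices not adjacent in $G$); the result is an Eulerian extension of $G$. $N_{ext}(G)$ denotes the minimum number of edges that must be added to $G$ to obtain an Eulerian extension of $G$. $t(G)$ denotes half the number of odd-degree vertices of $G$. The inequality in the conclusion is understood asymptotically, i.e. for all sufficiently large $n$. *)

(* Defs.v *)
From HB Require Import structures.
From mathcomp Require Import all_boot all_order all_algebra.
From mathcomp Require Import all_classical all_reals all_analysis.
Set Implicit Arguments. Unset Strict Implicit. Unset Printing Implicit Defensive.
Import Order.TTheory GRing.Theory Num.Theory.
Local Open Scope ring_scope.

Definition Kedges (n : nat) : {set {set 'I_n}} := [set e : {set 'I_n} | #|e| == 2%N].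

(* A (simple) graph on 'I_n is given by its edge set S \subset Kedges n. *)
Definition adj n (S : {set {set 'I_n}}) : rel 'I_n := fun u v => [set u; v] \in S.

Definition deg n (S : {set {set 'I_n}}) (u : 'I_n) : nat := #|[set e in S | u \in e]|.

Definition tG n (S : {set {set 'I_n}}) : nat := (#|[set u | odd (deg S u)]|)./2.

Definition eulerian n (S : {set {set 'I_n}}) : Prop :=
  exists (x0 : 'I_n) (xs : seq 'I_n),
    last x0 xs = x0 /\ perm_eq (pairmap (fun a b => [set a; b]) x0 xs) (enum S).

Definition Next_le n (S : {set {set 'I_n}}) (k : nat) : Prop :=
  exists F : {set {set 'I_n}},
    F \subset Kedges n :\: S /\ eulerian (S :|: F) /\ (#|F| <= k)%N.

Definition connectedG n (S : {set {set 'I_n}}) : Prop :=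
  forall u v : 'I_n, connect (adj S) u v.

Definition rg_prob (R : realType) n (p : {set 'I_n} -> R)
    (A : {set {set 'I_n}} -> Prop) : R :=
  \sum_(S : {set {set 'I_n}} | (S \subset Kedges n) && `[< A S >])
     \prod_(e in Kedges n) (if e \in S then p e else 1 - p e).

Definition avgp (R : realType) n (p : {set 'I_n} -> R) (u : 'I_n) : R :=
  (\sum_(v : 'I_n | v != u) p [set u; v]) / (n.-1)%:R.

Definition alpha_low (R : realType) n (p : {set 'I_n} -> R) : R :=
  match [pick u : 'I_n] with
  | Some u0 => \big[Num.min/avgp p u0]_(u : 'I_n) avgp p u
  | None => 0
  end.

Definition alpha_up (R : realType) n (p : {set 'I_n} -> R) : R :=
  match [pick u : 'I_n] with
  | Some u0 => \big[Num.max/avgp p u0]_(u : 'I_n) avgp p u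
  | None => 0
  end.

Definition alpha_e (R : realType) n (p : {set 'I_n} -> R) : R :=
  (\sum_(e in Kedges n) p e) / ('C(n, 2))%:R.

(* Main.v *)
(** Write [L = ln n].  If the complement of [G] joins any two vertices by a walk
    of length at most 3, then pairing up the odd vertices and adding the mod-2
    sum of the corresponding walks makes all degrees even at the cost of at
    most [3 t(G)] edges, and [G] being connected, the result is Eulerian.
    Two vertices without such a walk have disjoint closed neighbourhoods in the
    complement, with all pairs between them edges of [G].  This is impossible
    when all degrees are below [n/2], or when the product of the two
    neighbourhood sizes exceeds the number of edges.  By Chernoff's inequality
    and a union bound, with probability at least [1 - exp (- L^2 / 2)] all
    degrees are within [3 L sqrt n], and the number of edges within [3 n L],
    above their means.  These errors are absorbed by the margin [n^(1 - gamma)]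
    in the hypothesis: the two terms of its maximum correspond to the two ways
    of excluding the pair. *)

Require Import Defs.
From HB Require Import structures.
From mathcomp Require Import all_boot all_order all_algebra.
From mathcomp Require Import all_classical all_reals all_analysis.
From mathcomp Require Import zify ring lra.
Import Order.TTheory GRing.Theory Num.Theory.
Local Open Scope ring_scope.

Set Implicit Arguments.
Unset Strict Implicit.
Unset Printing Implicit Defensive.

(** * Euler's theorem: a connected graph with all degrees even has an Eulerian circuit *)

Section Euler.
Local Open Scope nat_scope.
Variables (n : nat) (S : {set {set 'I_n}}).
Hypothesis S_edges : S \subset Kedges n.

Definition walk_edges (x : 'I_n) (xs : seq 'I_n) : seq {set 'I_n} :=
  pairmap (fun a b => [set a; b]) x xs.

Definition trail (x : 'I_n) (xs : seq 'I_n) : bool :=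
  uniq (walk_edges x xs) && all (mem S) (walk_edges x xs).

Lemma KedgesP (e : {set 'I_n}) :
  reflect (exists a b : 'I_n, a != b /\ e = [set a; b]) (e \in Kedges n).
Proof.
by rewrite inE; exact: cards2P.
Qed.

Lemma Kedges2 (a b : 'I_n) : ([set a; b] \in Kedges n) = (a != b).
Proof. by rewrite inE cards2; case: (a != b). Qed.

Lemma adj_neq (a b : 'I_n) : [set a; b] \in S -> a != b.
Proof. by move=> /(fintype.subsetP S_edges); rewrite Kedges2. Qed.

Lemma mem_walk_edges (x : 'I_n) xs e v :
  e \in walk_edges x xs -> v \in e -> v \in x :: xs.
Proof.
elim: xs x => //= y xs IH x; rewrite inE => /orP[/eqP-> | /IH{}IH /IH].
  by rewrite !inE => /orP[] ->; rewrite ?orbT.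
by rewrite !inE => ->; rewrite orbT.
Qed.

(** An edge has two distinct ends, so it contributes the sum of the two indicators of its ends;
    modulo 2 these telescope along the walk. *)
Lemma odd_count_walk (x : 'I_n) xs v :
  all (mem S) (walk_edges x xs) ->
  odd (count (fun e : {set 'I_n} => v \in e) (walk_edges x xs)) =
    (v == x) (+) (v == last x xs).
Proof.
elim: xs x => [|y xs IH] x /=; first by rewrite addbb.
case/andP=> Sxy /IH{}IH; rewrite oddD IH !inE addbA; congr (_ (+) _).
have := adj_neq Sxy; have [->|] := eqVneq v x; last by case: (v == y).
by move/negbTE=> ->.
Qed.

Lemma deg_count (v : 'I_n) s :
  uniq s -> all (mem S) s -> (forall e, e \in S -> v \in e -> e \in s) ->
  deg S v = count (fun e : {set 'I_n} => v \in e) s.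
Proof.
move=> s_uniq /allP sS full; rewrite -size_filter /deg.
rewrite -(card_uniqP (filter_uniq _ s_uniq)); apply: eq_card => e.
rewrite inE mem_filter andbC; case ve: (v \in e) => //=.
by apply/idP/idP => [/full->|/sS].
Qed.

Lemma unused_edge (v : 'I_n) s :
  uniq s -> all (mem S) s ->
  deg S v != count (fun e : {set 'I_n} => v \in e) s ->
  exists w, [set v; w] \in S /\ [set v; w] \notin s.
Proof.
move=> s_uniq sS ndeg.
have [/existsP[e /and3P[eS ve es]]|/existsPn full] :=
    boolP [exists e : {set 'I_n}, [&& e \in S, v \in e & e \notin s]].
  have /KedgesP[a [b [_ eE]]] := fintype.subsetP S_edges _ eS.
  move: ve eS es; rewrite eE !inE => /orP[] /eqP <- eS es; first by exists b.
  by exists a; rewrite finset.setUC.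
case/eqP: ndeg; apply: deg_count => // e eS ve.
by have := full e; rewrite eS ve /= negbK.
Qed.

Lemma trail_rotate (x : 'I_n) xs v w :
  trail x xs -> last x xs = x -> v \in x :: xs ->
  [set v; w] \in S -> [set v; w] \notin walk_edges x xs ->
  exists ys, trail v ys /\ size ys = (size xs).+1.
Proof.
move=> /[swap] xsx /[swap] v_xs.
case/splitPl: v_xs xsx => s1 s2 s1v; rewrite last_cat s1v => s2x.
rewrite /trail => /andP[xs_uniq xsS] Svw new.
exists (s2 ++ s1 ++ [:: w]); split; last first.
  by rewrite !size_cat /= addn1 addnS addnC.
have pe : perm_eq (walk_edges v (s2 ++ s1 ++ [:: w]))
                  ([set v; w] :: walk_edges x (s1 ++ s2)).
  rewrite /walk_edges !pairmap_cat s2x s1v /= catA cats1 perm_rcons perm_cons.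
  by rewrite perm_catC.
by rewrite (perm_uniq pe) (perm_all _ pe) /= new xs_uniq Svw xsS.
Qed.

Hypothesis S_even : forall v, ~~ odd (deg S v).
Hypothesis S_conn : forall u v, connect (adj S) u v.

(** A trail that cannot be lengthened, even after rotation, is an Eulerian circuit. *)
Lemma trail_grow (x : 'I_n) xs :
  trail x xs ->
  (last x xs = x /\ perm_eq (walk_edges x xs) (enum S)) \/
  exists y ys, trail y ys /\ size ys = (size xs).+1.
Proof.
move=> tr; have /andP[xs_uniq xsS] := tr.
have [xsx|xsx] := eqVneq (last x xs) x; last first.
  right; case: (@unused_edge (last x xs) (walk_edges x xs)) => //.
    apply: contra (S_even (last x xs)) => /eqP->.
    by rewrite odd_count_walk // eqxx (negbTE xsx).
  move=> w [Sw new]; exists x, (rcons xs w); rewrite size_rcons; split=> //.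
  rewrite /trail /walk_edges -cats1 pairmap_cat /= cat_uniq all_cat /=.
  by rewrite Sw !andbT orbF new xs_uniq.
have [/existsP[v /existsP[w /and3P[vxs Svw new]]]|/existsPn full] :=
  boolP [exists v, exists w, [&& v \in x :: xs, [set v; w] \in S &
                              [set v; w] \notin walk_edges x xs]].
  by right; exists v; exact: trail_rotate new.
have used v w : v \in x :: xs -> [set v; w] \in S ->
    [set v; w] \in walk_edges x xs.
  by move=> vxs Svw; have /existsPn/(_ w) := full v; rewrite vxs Svw negbK.
left; split=> //; apply: uniq_perm => //; first exact: enum_uniq.
(* Every edge at a visited vertex is used, so the visited set is closed under adjacency; by
   connectivity it is everything. *)
have all_vertices v : v \in x :: xs.
  have : fingraph.closed (adj S) (mem (x :: xs)).
    have step a b : adj S a b -> a \in x :: xs -> b \in x :: xs.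
      move=> Sab /used/(_ Sab)/mem_walk_edges; apply.
      by rewrite !inE eqxx orbT.
    move=> a b Sab; apply/idP/idP; first exact: step.
    by apply: step; rewrite /adj finset.setUC.
  by move/closed_connect/(_ _ _ (S_conn x v)) => <-; rewrite inE eqxx.
move=> e; rewrite mem_enum; apply/idP/idP; first exact: (allP xsS).
move=> eS; have /KedgesP[a [b [_ eE]]] := fintype.subsetP S_edges _ eS.
by rewrite eE; apply: used; rewrite -?eE.
Qed.

Lemma even_connected_eulerian : 0 < n -> eulerian S.
Proof.
move=> n_gt0.
suff circ m x xs : trail x xs -> #|S| - size xs < m -> eulerian S.
  exact: (circ _ (Ordinal n_gt0) [::] _ (ltnSn _)).
elim: m x xs => // m IH x xs tr; rewrite ltnS => le_m.
case: (trail_grow tr) => [[? ?]|[y [ys [ys_tr ys_size]]]]; first by exists x, xs.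
apply: (IH y ys ys_tr); apply: leq_trans le_m.
have le_ys : size ys <= #|S|.
  case/andP: ys_tr => ys_uniq /allP ysS.
  rewrite -(size_pairmap (fun a b => [set a; b]) y) cardE.
  by apply: uniq_leq_size => // e /ysS; rewrite mem_enum.
by rewrite ys_size in le_ys *; rewrite subnS prednK // subn_gt0.
Qed.

End Euler.

(** * Symmetric difference as addition of sets modulo 2 *)

Section SymmetricDifference.
Local Open Scope nat_scope.
Variable T : finType.
Implicit Types A B C : {set T}.

Definition symdiff A B : {set T} := (A :\: B) :|: (B :\: A).

Lemma in_symdiff A B x : (x \in symdiff A B) = (x \in A) (+) (x \in B).
Proof. by rewrite !inE; case: (x \in A); case: (x \in B). Qed.

Lemma odd_card_symdiff A B : odd #|symdiff A B| = odd #|A| (+) odd #|B|.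
Proof.
have dis : [disjoint A :\: B & B :\: A].
  by rewrite -setI_eq0; apply/eqP/finset.setP => x; rewrite !inE;
     case: (x \in A); case: (x \in B).
rewrite cardsU (_ : _ :&: _ = finset.set0); last first.
  by apply/eqP; rewrite setI_eq0.
rewrite cards0 subn0 oddD -(cardsID B A) -(cardsID A B) !oddD.
by rewrite (finset.setIC B A); do 3 case: (odd _).
Qed.

Lemma card_symdiff_le A B : #|symdiff A B| <= #|A| + #|B|.
Proof.
apply: leq_trans (leq_card_setU _ _) _.
by rewrite leq_add // subset_leq_card // finset.subsetDl.
Qed.

Lemma symdiff_sub A B C : A \subset C -> B \subset C -> symdiff A B \subset C.
Proof.
move=> AC BC; rewrite finset.subUset.
by rewrite !(fintype.subset_trans (finset.subsetDl _ _)).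
Qed.

End SymmetricDifference.

(** * Correcting degree parities by short walks in the complement *)

Section ParityCorrection.
Local Open Scope nat_scope.
Variable n : nat.
Implicit Types (S F : {set {set 'I_n}}) (u v w z : 'I_n).

Lemma odd_deg_symdiff S F u :
  odd (deg (symdiff S F) u) = odd (deg S u) (+) odd (deg F u).
Proof.
rewrite /deg -odd_card_symdiff; congr (odd #|pred_of_set _|).
apply/finset.setP => e; rewrite inE !in_symdiff !inE.
by case: (u \in e); rewrite ?andbT ?andbF.
Qed.

Lemma handshake S : S \subset Kedges n -> \sum_u deg S u = (#|S|).*2.
Proof.
move=> SK; rewrite -muln2 -sum_nat_const.
have degE u : deg S u = \sum_(e in S) (u \in e).
  rewrite /deg -sum1_card big_mkcond [RHS]big_mkcond /=.
  by apply: eq_bigr => e _; rewrite inE; case: (e \in S); case: (u \in e).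
rewrite (eq_bigr _ (fun u _ => degE u)) exchange_big /=.
apply: eq_bigr => e eS.
have /eqP <- : #|e| == 2 by have := fintype.subsetP SK _ eS; rewrite inE.
by rewrite -sum1_card [RHS]big_mkcond.
Qed.

Lemma odd_sum (I : finType) (f : I -> nat) :
  odd (\sum_i f i) = odd #|[set i | odd (f i)]|.
Proof.
rewrite -sum1_card [in RHS]big_mkcond /=.
apply: (big_ind2 (fun a b => odd a = odd b)) => //.
  by move=> a b c d ab cd; rewrite !oddD ab cd.
by move=> i _; rewrite inE; case: (odd (f i)).
Qed.

(** The handshake identity modulo 2; it allows the odd vertices to be paired off. *)
Lemma even_odd_vertices S :
  S \subset Kedges n -> ~~ odd #|[set u | odd (deg S u)]|.
Proof. by move=> SK; rewrite -odd_sum handshake // odd_double. Qed.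

(* A degenerate pair [a = b] contributes no edge, so that walks in the
   complement may stay in place. *)
Definition opt_edge (a b : 'I_n) : {set {set 'I_n}} :=
  if a == b then finset.set0 else [set [set a; b]].

Lemma odd_deg_opt_edge a b u :
  odd (deg (opt_edge a b) u) = (u == a) (+) (u == b).
Proof.
rewrite /opt_edge /deg; have [->|ab] := eqVneq a b.
  rewrite addbb (_ : [set _ in _ | _] = finset.set0) ?cards0 //.
  by apply/finset.setP => e; rewrite !inE.
have [|uab] := boolP (u \in [set a; b]); last first.
  rewrite (_ : [set _ in _ | _] = finset.set0) ?cards0; last first.
    apply/finset.setP => e; rewrite finset.in_set finset.in_set1 finset.in_set0.
    by apply/negbTE; apply: contra uab => /andP[/eqP->].
  by move: uab; rewrite !inE negb_or => /andP[/negbTE-> /negbTE->].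
move=> uab; rewrite (_ : [set _ in _ | _] = [set [set a; b]]) ?cards1; last first.
  by apply/finset.setP => e; rewrite finset.in_set finset.in_set1; case: eqP => // ->; rewrite uab.
move: uab; rewrite !inE => /orP[] /eqP->; rewrite eqxx.
  by rewrite (negbTE ab).
by rewrite eq_sym (negbTE ab).
Qed.

(** Reflexive, so that neighbourhoods are closed and three steps cover every walk of length at most
    3. *)
Definition co_adj S : rel 'I_n := fun a b => (a == b) || ([set a; b] \notin S).

Lemma opt_edge_sub S a b : co_adj S a b -> opt_edge a b \subset Kedges n :\: S.
Proof.
rewrite /co_adj /opt_edge; have [_ _|ab /= abS] := eqVneq a b.
  by rewrite finset.sub0set.
by rewrite finset.sub1set inE abS Kedges2.
Qed.

Lemma card_opt_edge a b : #|opt_edge a b| <= 1.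
Proof. by rewrite /opt_edge; case: eqP => _; rewrite ?cards0 ?cards1. Qed.

Definition co_dist3 S u v :=
  exists w z, [/\ co_adj S u w, co_adj S w z & co_adj S z v].

(** In the mod-2 sum of the steps of the walk, the inner vertices [w] and [z] each occur twice and
    cancel; repeated edges only make the sum smaller. *)
Lemma co_dist3_correction S u v :
  co_dist3 S u v -> exists F, [/\ F \subset Kedges n :\: S, #|F| <= 3
    & forall x, odd (deg F x) = (x == u) (+) (x == v)].
Proof.
move=> [w [z [uw wz zv]]].
exists (symdiff (symdiff (opt_edge u w) (opt_edge w z)) (opt_edge z v)); split.
- by rewrite !symdiff_sub ?opt_edge_sub.
- rewrite -[3]/(1 + 1 + 1); apply: leq_trans (card_symdiff_le _ _) _.
  apply: leq_add (card_opt_edge _ _); apply: leq_trans (card_symdiff_le _ _) _.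
  by rewrite leq_add ?card_opt_edge.
- move=> x; rewrite !odd_deg_symdiff !odd_deg_opt_edge.
  by do !case: (_ == _).
Qed.

(** Consecutive elements of [s] are paired and their corrections added modulo 2. As [s] has no
    repetition, the parities of different pairs do not interfere. *)
Lemma parity_correction S (s : seq 'I_n) :
  (forall u v, co_dist3 S u v) -> uniq s -> ~~ odd (size s) ->
  exists F, [/\ F \subset Kedges n :\: S, #|F| <= 3 * (size s)./2
    & forall x, odd (deg F x) = (x \in s)].
Proof.
move=> d3; have [m] := ubnP (size s); elim: m s => // m IH [|u [|v s]] //= sm.
  move=> _ _; exists finset.set0; rewrite finset.sub0set cards0; split=> // x.
  by rewrite /deg (_ : [set _ in _ | _] = finset.set0) ?cards0 //;
     apply/finset.setP => e; rewrite !inE.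
rewrite negbK inE negb_or => /and3P[/andP[uv us] vs s_uniq] ev.
have [|//|//|F [FK F_le F_odd]] := IH s; first by apply: ltnW; rewrite ltnS in sm.
have [F' [F'K F'_le F'_odd]] := co_dist3_correction (d3 u v).
exists (symdiff F' F); split; first exact: symdiff_sub.
  by apply: leq_trans (card_symdiff_le _ _) _; rewrite mulnS leq_add.
move=> x; rewrite odd_deg_symdiff F_odd F'_odd !inE.
have [->|xu] := eqVneq x u; first by rewrite (negbTE uv) (negbTE us).
by have [->|xv] := eqVneq x v; first by rewrite (negbTE vs).
Qed.

Lemma Next_le_of_dist3 S :
  0 < n -> S \subset Kedges n -> connectedG S -> (forall u v, co_dist3 S u v) ->
  Next_le S (3 * tG S).
Proof.
move=> n_gt0 SK conn d3.
have evT := even_odd_vertices SK.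
case: (@parity_correction S (enum [set u | odd (deg S u)])) => //.
- exact: enum_uniq.
- by rewrite -cardE.
move=> F [FK F_le F_odd]; exists F; split=> //; split; last first.
  by move: F_le; rewrite -cardE.
(* [F] avoids [S], so the union is a mod-2 sum, for which degree parities add. *)
have -> : S :|: F = symdiff S F.
  apply/finset.setP => e; rewrite in_symdiff inE.
  case eF: (e \in F); last by rewrite orbF addbF.
  by have := fintype.subsetP FK _ eF; rewrite inE => /andP[/negbTE->].
apply: even_connected_eulerian => //.
- by apply: symdiff_sub => //; apply: fintype.subset_trans FK (finset.subsetDl _ _).
- by move=> v; rewrite odd_deg_symdiff F_odd mem_enum inE addbb.
- move=> u v; apply: connect_sub (conn u v) => a b ab; apply: connect1.
  rewrite /adj in_symdiff; move: (ab); rewrite /adj => -> /=.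
  by apply/negP => /(fintype.subsetP FK); rewrite inE (ab : [set a; b] \in S).
Qed.

(** A vertex [w] outside the closed neighbourhood gives the edge from [u] to [w] in [S], and
    distinct [w] give distinct edges at [u]. *)
Lemma closed_nbhd_card S u :
  S \subset Kedges n -> n - deg S u <= #|[set w | co_adj S u w]|.
Proof.
move=> SK; set A := [set w | co_adj S u w].
rewrite leq_subLR addnC -{1}(card_ord n) -cardsT -(cardsID A) finset.setTI leq_add2l.
have inj : {in finset.setT :\: A &, injective (fun w => [set u; w])}.
  move=> w w'; rewrite !inE /co_adj !negb_or !negbK => /andP[/andP[uw _] _].
  move=> _ /finset.setP/(_ w); rewrite !inE eqxx orbT eq_sym (negbTE uw) /=.
  by move/esym/eqP.
rewrite -(card_in_imset inj) subset_leq_card //; apply/fintype.subsetP => e.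
case/imsetP => w; rewrite !inE /co_adj negb_or negbK => /andP[/andP[_ uw] _] ->.
by rewrite uw finset.setU11.
Qed.

Lemma co_dist3I S u v w : co_adj S u w -> co_adj S v w -> co_dist3 S u v.
Proof.
move=> uw vw; exists w, w; split=> //; first by rewrite /co_adj eqxx.
by move: vw; rewrite /co_adj eq_sym finset.setUC.
Qed.

(** Both closed neighbourhoods in the complement have more than [n / 2] elements, so they meet. *)
Lemma co_dist3_small_deg S u v :
  S \subset Kedges n -> 2 * deg S u < n -> 2 * deg S v < n -> co_dist3 S u v.
Proof.
move=> SK du dv.
have [w /andP[]|dis] := pickP [pred w | co_adj S u w && co_adj S v w].
  exact: co_dist3I.
have := max_card [set w | co_adj S u w || co_adj S v w].
rewrite card_ord (_ : [set w | _] = [set w | co_adj S u w] :|: [set w | co_adj S v w]);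
  last by apply/finset.setP => w; rewrite !inE.
rewrite cardsU (_ : _ :&: _ = finset.set0); last first.
  by apply/finset.setP => w; rewrite !inE; exact: dis.
rewrite cards0 subn0 leqNgt => /negP[]; apply: leq_trans (leq_add _ _);
  [|exact: closed_nbhd_card..].
by lia.
Qed.

(** Otherwise the closed neighbourhoods [A] and [B] are disjoint and every pair in their product is
    an edge of [S]. Disjointness makes these edges distinct, so [S] has at least [#|A| * #|B|] of
    them. *)
Lemma co_dist3_few_edges S u v :
  S \subset Kedges n -> #|S| < (n - deg S u) * (n - deg S v) -> co_dist3 S u v.
Proof.
move=> SK few.
have [w /andP[]|dis] := pickP [pred w | co_adj S u w && co_adj S v w].
  exact: co_dist3I.
pose A := [set w | co_adj S u w]; pose B := [set w | co_adj S v w].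
have [[w z] /= /and3P[uw zv wz]|no_edge] :=
    pickP [pred q | [&& q.1 \in A, q.2 \in B & co_adj S q.1 q.2]].
  rewrite !inE in uw zv; exists w, z; split=> //.
  by move: zv; rewrite /co_adj eq_sym finset.setUC.
have disAB w : w \in A -> w \in B = false.
  by rewrite !inE => uw; have := dis w; rewrite /= uw.
have inj : {in finset.setX A B &, injective (fun q => [set q.1; q.2])}.
  move=> [a b] [a' b']; rewrite !finset.in_setX /= => /andP[aA bB] /andP[a'A b'B] eq_ab.
  have aa' : a = a'.
    have /finset.setP/(_ a) := eq_ab; rewrite !inE eqxx /= => /esym/orP[/eqP//|/eqP ab'].
    by have := disAB _ aA; rewrite ab' b'B.
  have /finset.setP/(_ b) := eq_ab; rewrite !inE eqxx orbT => /esym/orP[/eqP ba'|/eqP->].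
    by have := disAB _ a'A; rewrite -ba' bB.
  by rewrite aa'.
move: few; rewrite ltnNge => /negP[].
apply: leq_trans (leq_mul (closed_nbhd_card u SK) (closed_nbhd_card v SK)) _.
rewrite -cardsX -(card_in_imset inj) subset_leq_card //.
apply/fintype.subsetP => e /imsetP[[a b]]; rewrite finset.in_setX => /andP[aA bB] ->.
have := no_edge (a, b); rewrite /= aA bB /co_adj /= => /negbT.
by rewrite negb_or negbK => /andP[].
Qed.

End ParityCorrection.

(** * The random graph measure: union bound and Chernoff's inequality *)

Section RandomGraph.
Variables (R : realType) (n : nat) (p : {set 'I_n} -> R).
Hypothesis p01 : forall e, e \in Kedges n -> 0 <= p e <= 1.
Implicit Types (A B : {set {set 'I_n}} -> Prop) (S T : {set {set 'I_n}}).

Lemma sum_subsets_prod (I : finType) (K : {set I}) (f g : I -> R) :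
  \sum_(S : {set I} | S \subset K) \prod_(e in K) (if e \in S then f e else g e)
    = \prod_(e in K) (f e + g e).
Proof.
(* Extending by 0 and 1 off [K] kills the subsets not contained in [K] and leaves the other products
   unchanged, so that distributivity over the whole type applies. *)
pose f' e := if e \in K then f e else 0.
pose g' e := if e \in K then g e else 1.
transitivity (\prod_e (f' e + g' e)); last first.
  rewrite [RHS]big_mkcond; apply: eq_bigr => e _.
  by rewrite /f' /g'; case: ifP => // _; rewrite add0r.
rewrite bigA_distr big_mkcond /=; apply: eq_bigr => S _.
case: ifPn => [SK|/subsetPn[e eS eK]]; last first.
  by rewrite (bigD1 e) //= eS /f' (negbTE eK) mul0r.
rewrite big_mkcond; apply: eq_bigr => e _; rewrite /f' /g'.
by case: ifPn => // eK; rewrite ifN //; apply: contra eK; exact: fintype.subsetP.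
Qed.

Definition weight S : R := \prod_(e in Kedges n) (if e \in S then p e else 1 - p e).

Lemma weight_ge0 S : 0 <= weight S.
Proof.
apply: prodr_ge0 => e /p01/andP[p0 p1]; case: ifP => // _.
by rewrite subr_ge0.
Qed.

Lemma rg_prob_total : rg_prob p (fun=> True) = 1.
Proof.
rewrite /rg_prob; under eq_bigl do rewrite asboolT // andbT.
rewrite sum_subsets_prod big1 // => e _.
by rewrite addrC subrK.
Qed.

Lemma rg_probE A :
  rg_prob p A = \sum_(S : {set {set 'I_n}} | S \subset Kedges n)
                  (if `[< A S >] then weight S else 0).
Proof. by rewrite /rg_prob big_mkcondr. Qed.

(** The union bound, with one event [B] kept apart from the indexed family. *)
Lemma rg_prob_cover (I : finType) A B (C : I -> {set {set 'I_n}} -> Prop) :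
  (forall S, S \subset Kedges n -> A S -> B S \/ exists i, C i S) ->
  rg_prob p A <= rg_prob p B + \sum_i rg_prob p (C i).
Proof.
move=> cover; rewrite !rg_probE.
under [X in _ + X]eq_bigr do rewrite rg_probE.
rewrite exchange_big /= -big_split /=; apply: ler_sum => S SK.
have sum_ge0 (P : pred I) :
    0 <= \sum_(i | P i) (if `[< C i S >] then weight S else 0).
  by apply: sumr_ge0 => i _; case: ifP => // _; exact: weight_ge0.
case: asboolP => [/(cover _ SK)|_]; last first.
  by rewrite addr_ge0 //; case: ifP => // _; exact: weight_ge0.
case=> [BS|[i Ci]].
  by rewrite (asboolT BS) lerDl.
rewrite (bigD1 i) //= (asboolT Ci) addrCA lerDl addr_ge0 //.
by case: ifP => // _; exact: weight_ge0.
Qed.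

(** From [1 - t <= expR (- t)] one gets [(1 - t) * expR t <= 1], while [(1 - t) * (1 + t + 2 * t ^+
    2) = 1 + t ^+ 2 * (1 - 2 * t)] is at least 1. *)
Lemma expR_le_quadratic (t : R) : 0 <= t -> t <= 2^-1 ->
  expR t <= 1 + t + 2 * t ^+ 2.
Proof.
move=> t0 t1; have := expR_ge1Dx (- t); rewrite expRN => le_inv.
have e0 := expR_gt0 t.
have := ler_wpM2r (ltW e0) le_inv; rewrite mulVf ?gt_eqF //.
nra.
Qed.

(** The moment generating function of the number of edges in [T], which factors by independence. *)
Lemma sum_weight_expR T (t : R) : T \subset Kedges n ->
  \sum_(S : {set {set 'I_n}} | S \subset Kedges n)
     weight S * expR (#|S :&: T|%:R * t)
  = \prod_(e in T) (p e * expR t + (1 - p e)).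
Proof.
move=> TK; pose x e : R := if e \in T then expR t else 1.
transitivity (\prod_(e in Kedges n) (p e * x e + (1 - p e))); last first.
  rewrite big_mkcond [RHS]big_mkcond; apply: eq_bigr => e _; rewrite /x.
  case eT: (e \in T); first by rewrite (fintype.subsetP TK _ eT).
  by case: ifP => // _; rewrite mulr1 addrC subrK.
rewrite -sum_subsets_prod; apply: eq_bigr => S SK.
rewrite expRM_natl -prodr_const.
rewrite (big_mkcond (fun e => e \in S :&: T)) /weight.
rewrite [X in X * _]big_mkcond -big_split [RHS]big_mkcond; apply: eq_bigr => e _ /=.
rewrite finset.in_setI /x; case eK: (e \in Kedges n); last first.
  rewrite mul1r ifF //; apply/negbTE/negP => /andP[/(fintype.subsetP SK)].
  by rewrite eK.
by case: (e \in S); case: (e \in T); rewrite ?mulr1.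
Qed.

(** Markov's inequality for [expR (#|S :&: T|%:R * t)]. Each factor of its mean is at most
    [1 + p e * (t + 2 * t ^+ 2)], hence at most [expR (t * p e + 2 * t ^+ 2)]. *)
Lemma chernoff_upper T (a t : R) :
  T \subset Kedges n -> 0 <= t -> t <= 2^-1 ->
  rg_prob p (fun S => \sum_(e in T) p e + a <= #|S :&: T|%:R)
    <= expR (2 * t ^+ 2 * #|T|%:R - t * a).
Proof.
move=> TK t0 t1; set m := \sum_(e in T) p e.
rewrite rg_probE.
apply: (@le_trans _ _ (\sum_(S : {set {set 'I_n}} | S \subset Kedges n)
   (weight S * expR (#|S :&: T|%:R * t)) * expR (- (t * (m + a))))).
  apply: ler_sum => S _; rewrite -mulrA -expRD.
  case: asboolP => [le_S|_]; last first.
    by rewrite mulr_ge0 ?weight_ge0 ?expR_ge0.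
  rewrite -{1}[weight S]mulr1 ler_wpM2l ?weight_ge0 //.
  by rewrite -[leLHS]expR0 ler_expR subr_ge0 [leLHS]mulrC ler_wpM2r.
rewrite -mulr_suml sum_weight_expR //.
have le_prod : \prod_(e in T) (p e * expR t + (1 - p e))
    <= \prod_(e in T) expR (t * p e + 2 * t ^+ 2).
  apply: ler_prod => e eT; have /andP[p0 p1] := p01 (fintype.subsetP TK _ eT).
  have e0 := expR_gt0 t; apply/andP; split; first by nra.
  apply: le_trans (expR_ge1Dx _).
  have := ler_wpM2l p0 (expR_le_quadratic t0 t1).
  have := ler_wpM2r (mulr_ge0 (ler0n R 2) (sqr_ge0 t)) p1.
  lra.
apply: le_trans (ler_wpM2r (expR_ge0 _) le_prod) _.
rewrite -expR_sum big_split /= -mulr_sumr sumr_const -expRD ler_expR.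
rewrite -[_ *+ #|T|]mulr_natr -/m; lra.
Qed.

End RandomGraph.

(** * Concentration of degrees and edge count, and the bound for fixed [n] *)

Section Concentration.
Variables (R : realType) (n : nat).
Implicit Types (S : {set {set 'I_n}}) (p : {set 'I_n} -> R).

(** The deterministic part. It is applied with [a] the value [alpha_up], [r] the root of
    [alpha_e / 2], [q] the margin, [s] the root of [n] and [L] the logarithm; then
    [n%:R * n.-1%:R * r ^+ 2] is the mean number of edges. *)
Lemma co_dist3_of_bounds S (a r q s L : R) :
  (1 < n)%N -> S \subset Kedges n -> 0 <= s -> s ^+ 2 = n%:R ->
  0 <= r <= 1 -> 1 <= L -> 10 * L <= q * s ->
  a <= Num.max 2^-1 (1 - r) - q ->
  (forall u, (deg S u)%:R <= n.-1%:R * a + 3 * (s * L)) ->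
  #|S|%:R <= n%:R * n.-1%:R * r ^+ 2 + 3 * (n%:R * L) ->
  forall u v, co_dist3 S u v.
Proof.
move=> n_gt1 SK s0 s2 /andP[r0 r1] L1 qs le_a le_deg le_S u v.
have nE : n%:R = n.-1%:R + 1 :> R by rewrite natr1 prednK // ltnW.
have m1 : 1 <= n.-1%:R :> R by rewrite ler1n -ltnS prednK // ltnW.
set m := n.-1%:R in nE m1 le_deg le_S.
have sL0 : 0 <= s * L by rewrite mulr_ge0 //; lra.
have nq : 10 * (s * L) <= n%:R * q.
  by have := ler_wpM2l s0 qs; rewrite -s2; lra.
(* Half of the previous bound, since [n = m + 1] is at most [2 * m]. *)
have mq : 5 * (s * L) <= m * q.
  have q0 : 0 <= q.
    by rewrite -(pmulr_rge0 _ (_ : 0 < n%:R)) ?ltr0n; [lra | exact: ltnW].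
  by have := ler_wpM2r q0 m1; move: nq; rewrite nE mulrDl; lra.
have [le_half|gt_half] := leP (1 - r) 2^-1.
  have small w : (2 * deg S w < n)%N.
    rewrite -(ltr_nat R) natrM; apply: (@le_lt_trans _ _ (2 * (m * a + 3 * (s * L)))).
      by rewrite ler_pM2l.
    have : m * a <= m * (2^-1 - q).
      by rewrite ler_wpM2l ?ler0n //; move: le_a; rewrite max_l.
    by rewrite nE mulrBr; lra.
  exact: co_dist3_small_deg.
(* [(1 + m r)^2 >= n m r^2] as [r <= 1], and the square of the remaining term
   [2 s L] absorbs the fluctuation [3 n L] of the number of edges. *)
apply: co_dist3_few_edges => //; rewrite -(ltr_nat R) natrM.
pose y := 1 + m * r + 2 * (s * L).
have mr0 : 0 <= m * r by rewrite mulr_ge0 ?ler0n.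
have y0 : 0 <= y by rewrite /y; lra.
(* The margin [m * q] gives at least [5 * (s * L)], the degree fluctuation takes [3 * (s * L)], and
   2 remain. *)
have le_y w : y <= (n - deg S w)%N%:R.
  apply: (@le_trans _ _ (n%:R - (deg S w)%:R)); last first.
    by rewrite lerBlDr -natrD ler_nat addnC -leq_subLR.
  have : m * a <= m * (1 - r - q).
    by rewrite ler_wpM2l ?ler0n //; move: le_a; rewrite max_r // ltW.
  by have := le_deg w; rewrite nE /y !mulrBr; lra.
apply: lt_le_trans (ler_pM y0 y0 (le_y u) (le_y v)).
apply: le_lt_trans le_S _.
have L2 : 4 * (n%:R * L) <= (2 * (s * L)) ^+ 2.
  rewrite !exprMn s2 -[2 ^+ 2]/(2 * 2) expr2 !mulrA [2 * 2]mulrC.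
  have : n%:R * L * 1 <= n%:R * L * L.
    by apply: ler_wpM2l => //; rewrite mulr_ge0 ?ler0n //; lra.
  lra.
have nL0 : 0 <= n%:R * L by rewrite mulr_ge0 ?ler0n //; lra.
have cross : 0 <= (1 + m * r) * (s * L) by rewrite mulr_ge0 //; lra.
have r2 : m * r ^+ 2 <= m * r.
  by rewrite ler_wpM2l ?ler0n // expr2 -[leRHS]mulr1 ler_wpM2l.
rewrite /y nE in L2 nL0 *; nra.
Qed.

(** Turns the degree of [u] into a count [#|S :&: T|], the form that the Chernoff bound treats. *)
Definition star (u : 'I_n) : {set {set 'I_n}} := [set e in Kedges n | u \in e].

Lemma star_imset u : star u = [set [set u; v] | v in [set~ u]].
Proof.
apply/finset.setP => e; apply/idP/imsetP => [|[v]].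
  rewrite finset.in_set => /andP[/KedgesP[a [b [ab ->]]]].
  rewrite !inE => /orP[] /eqP->; first by exists b; rewrite ?inE // eq_sym.
  by exists a; rewrite ?inE // finset.setUC.
by rewrite finset.in_setC1 => vu ->; rewrite finset.in_set Kedges2 eq_sym vu finset.set21.
Qed.

Lemma pair_inj (u : 'I_n) : {in [set~ u] &, injective (fun v => [set u; v])}.
Proof.
move=> v w; rewrite !inE => vu _ /finset.setP/(_ v).
by rewrite !inE eqxx orbT (negbTE vu) /= => /esym/eqP.
Qed.

Lemma sum_star p u : (1 < n)%N -> \sum_(e in star u) p e = n.-1%:R * avgp p u.
Proof.
move=> n_gt1; rewrite star_imset big_imset; last exact: pair_inj.
rewrite /avgp mulrCA mulfV ?mulr1; last by rewrite pnatr_eq0; lia.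
by apply: eq_bigl => v; rewrite !inE.
Qed.

Lemma card_star_le u : (#|star u| <= n)%N.
Proof.
rewrite star_imset; apply: leq_trans (leq_imset_card _ _) _.
by apply: leq_trans (max_card _) _; rewrite card_ord.
Qed.

Lemma deg_star S u : S \subset Kedges n -> deg S u = #|S :&: star u|.
Proof.
move=> SK; apply: eq_card => e; rewrite !inE; case eS: (e \in S) => //=.
by have := fintype.subsetP SK _ eS; rewrite inE => ->.
Qed.

Lemma avgp_le_alpha_up p u : avgp p u <= alpha_up p.
Proof. by rewrite /alpha_up; case: pickP => [u0 _|/(_ u)//]; exact: le_bigmax. Qed.

Lemma card_Kedges : #|Kedges n| = 'C(n, 2).
Proof. by rewrite /Kedges card_draws card_ord. Qed.

Lemma bin2R : 'C(n, 2)%:R = n%:R * n.-1%:R / 2 :> R.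
Proof.
apply: (@mulIf _ 2); rewrite ?pnatr_eq0 // mulfVK ?pnatr_eq0 //.
by rewrite -!natrM; congr (_%:R); rewrite -[2%N]/(2`!) bin_ffact ffactnS ffactn1.
Qed.

Lemma sum_Kedges p : (1 < n)%N -> \sum_(e in Kedges n) p e = 'C(n, 2)%:R * alpha_e p.
Proof.
move=> n_gt1; rewrite /alpha_e mulrCA mulfV ?mulr1 //.
by rewrite pnatr_eq0 -lt0n bin_gt0.
Qed.

Lemma alpha_e01 p : (1 < n)%N ->
  (forall e, e \in Kedges n -> 0 <= p e <= 1) -> 0 <= alpha_e p <= 1.
Proof.
move=> n_gt1 p01; have C0 : 0 < 'C(n, 2)%:R :> R by rewrite ltr0n bin_gt0.
apply/andP; split.
  by apply: divr_ge0 (ltW C0); apply: sumr_ge0 => e /p01/andP[].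
rewrite /alpha_e ler_pdivrMr // mul1r -card_Kedges -sumr_const.
by apply: ler_sum => e /p01/andP[].
Qed.

Lemma rg_prob_Next_le p (q : R) :
  (1 < n)%N -> (forall e, e \in Kedges n -> 0 <= p e <= 1) ->
  alpha_up p <= Num.max 2^-1 (1 - Num.sqrt (alpha_e p / 2)) - q ->
  q <= 1 -> 3 <= ln (n%:R : R) -> 10 * ln (n%:R : R) <= q * Num.sqrt n%:R ->
  1 - expR (- (2^-1 * ln (n%:R : R) ^+ 2)) - rg_prob p (fun S => ~ connectedG S)
    <= rg_prob p (fun S => Next_le S (3 * tG S)).
Proof.
move=> n_gt1 p01 le_up q1; set L := ln _; set s := Num.sqrt _ => L3 qs.
have n0 : 0 < n%:R :> R by rewrite ltr0n ltnW.
have s2 : s ^+ 2 = n%:R by rewrite sqr_sqrtr // ltW.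
have s0 : 0 < s by rewrite sqrtr_gt0.
(* This keeps both Chernoff parameters, [L / s] and [L / n%:R], below [1 / 2]. *)
have s10 : 10 * L <= s by apply: le_trans qs _; rewrite ler_piMl // ltW.
have sn : s <= n%:R by rewrite -s2 expr2 ler_peMl ?ltW //; lra.
pose many_edges S := \sum_(e in Kedges n) p e + 3 * (n%:R * L)
                       <= #|S :&: Kedges n|%:R.
pose big_deg (u : 'I_n) S := \sum_(e in star u) p e + 3 * (s * L)
                       <= #|S :&: star u|%:R.
(* Chernoff with parameter [L / sqrt n] for the degrees and [L / n] for the
   edges: the exponents are at most [2 L^2 - 3 L^2]. *)
have P_deg u : rg_prob p (big_deg u) <= expR (- L ^+ 2).
  have t0 : 0 <= L / s by rewrite divr_ge0 ?ltW //; lra.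
  have t1 : L / s <= 2^-1 by rewrite ler_pdivrMr //; lra.
  apply: le_trans (chernoff_upper p01 _ _ t0 t1) _.
    by apply/fintype.subsetP => e; rewrite finset.in_set => /andP[].
  rewrite ler_expR (_ : L / s * _ = 3 * L ^+ 2); last by field; rewrite gt_eqF.
  suff : (L / s) ^+ 2 * #|star u|%:R <= L ^+ 2 by rewrite -mulrA; lra.
  rewrite expr_div_n s2 -mulrA ler_piMr ?sqr_ge0 // mulrC.
  by rewrite ler_pdivrMr // mul1r ler_nat card_star_le.
have P_edges : rg_prob p many_edges <= expR (- L ^+ 2).
  have t0 : 0 <= L / n%:R by rewrite divr_ge0 ?ltW //; lra.
  have t1 : L / n%:R <= 2^-1 by rewrite ler_pdivrMr //; lra.
  apply: le_trans (chernoff_upper p01 _ _ t0 t1) _ => //.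
  rewrite ler_expR (_ : L / n%:R * _ = 3 * L ^+ 2); last by field; rewrite gt_eqF.
  suff : (L / n%:R) ^+ 2 * #|Kedges n|%:R <= L ^+ 2 by rewrite -mulrA; lra.
  rewrite expr_div_n -mulrA ler_piMr ?sqr_ge0 // mulrC ler_pdivrMr ?exprn_gt0 //.
  rewrite mul1r card_Kedges bin2R.
  have : n.-1%:R <= n%:R :> R by rewrite ler_nat leq_pred.
  have := ler0n R n.-1; nra.
have good S : S \subset Kedges n -> connectedG S -> ~ many_edges S ->
    (forall u, ~ big_deg u S) -> Next_le S (3 * tG S).
  move=> SK conn /negP; rewrite -ltNge (finset.setIidPl SK) => few ndeg.
  have /andP[e0 e1] := alpha_e01 n_gt1 p01.
  apply: Next_le_of_dist3 => //; first exact: ltnW.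
  apply: (@co_dist3_of_bounds S (alpha_up p) (Num.sqrt (alpha_e p / 2)) q s L) => //.
  - exact: ltW.
  - rewrite sqrtr_ge0 /= -[leRHS]sqrtr1 ler_sqrt ?ltr01 //; lra.
  - lra.
  - move=> u; rewrite deg_star // ltW //.
    have /negP := ndeg u; rewrite /big_deg -ltNge => /lt_le_trans; apply.
    rewrite lerD2r sum_star // ler_wpM2l ?ler0n //; exact: avgp_le_alpha_up.
  - rewrite sqr_sqrtr; last by rewrite divr_ge0.
    by move: (ltW few); rewrite sum_Kedges // bin2R; lra.
(* The union bound is applied twice: the total mass 1 is covered by [B] and the [n] large-degree
   events, then [B] by its three parts. *)
pose B S := Next_le S (3 * tG S) \/ ~ connectedG S \/ many_edges S.
have cover_deg : 1 <= rg_prob p B + \sum_u rg_prob p (big_deg u).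
  rewrite -(rg_prob_total p); apply: rg_prob_cover => // S SK _.
  have [|ndeg] := pselect (exists u, big_deg u S); first by right.
  left; have [conn|] := pselect (connectedG S); last by right; left.
  have [|few] := pselect (many_edges S); first by right; right.
  by left; apply: good => // u bu; apply: ndeg; exists u.
have cover_B : rg_prob p B <= rg_prob p (fun S => Next_le S (3 * tG S))
    + \sum_(b : bool) rg_prob p (if b then fun S => ~ connectedG S else many_edges).
  apply: rg_prob_cover => // S SK [|[disc|many]]; first by left.
    by right; exists true.
  by right; exists false.
rewrite big_bool /= in cover_B.
have sum_deg : \sum_u rg_prob p (big_deg u) <= n%:R * expR (- L ^+ 2).
  apply: le_trans (ler_sum _ (fun u _ => P_deg u)) _.
  by rewrite sumr_const card_ord mulr_natl.
(* There are [n + 1] exceptional events, and [n + 1 <= 2 * n <= expR (L + 1)]; finally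
   [L + 1 <= L ^+ 2 / 2] as [L] is at least 3. *)
have tail : (n%:R + 1) * expR (- L ^+ 2) <= expR (- (2^-1 * L ^+ 2)).
  have e1 : 2 <= expR 1 :> R by have := expR_ge1Dx (1 : R); lra.
  apply: (@le_trans _ _ (expR (L + 1) * expR (- L ^+ 2))).
    apply: ler_wpM2r; first exact: expR_ge0.
    rewrite expRD lnK ?posrE // mulrC.
    have := ler_wpM2r (ltW n0) e1.
    have : 1 <= n%:R :> R by rewrite ler1n ltnW.
    lra.
  by rewrite -expRD ler_expR; nra.
lra.
Qed.

End Concentration.

(** * Growth of logarithms against powers, and the asymptotic statement *)

Section Asymptotics.
Variable R : realType.

Lemma ln_nat_ge (M : R) : exists N, forall n, (N <= n)%N -> M <= ln (n%:R : R).
Proof.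
exists (Num.bound (expR M)) => n le_n.
have lt_n : expR M < n%:R.
  by apply: lt_le_trans (archi_boundP (expR_ge0 M)) _; rewrite ler_nat.
by rewrite -[M]expRK ler_ln ?posrE ?expR_gt0 ?ltW // (lt_trans (expR_gt0 M)).
Qed.

Lemma powR_dominates_ln (c d : R) : 0 < c -> 0 < d ->
  exists N, forall n, (N <= n)%N -> c * ln (n%:R : R) <= n%:R `^ d.
Proof.
(* With [L = ln n], the power is the square of [expR (d * L / 2)], hence at least
   [(d * L / 2) ^+ 2]; this exceeds [c * L] once [L] reaches the chosen threshold. *)
move=> c0 d0; have [N le_ln] := ln_nat_ge (4 * c / d ^+ 2).
exists (maxn 1 N) => n; rewrite geq_max => /andP[n1 /le_ln].
set L := ln _ => L_ge.
have L0 : 0 <= L by apply: le_trans L_ge; rewrite divr_ge0 ?sqr_ge0 //; lra.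
rewrite /powR pnatr_eq0 gtn_eqF // -/L.
have half_ge : d * L / 2 <= expR (d * L / 2).
  by apply: le_trans (expR_ge1Dx _); lra.
apply: (@le_trans _ _ ((d * L / 2) ^+ 2)).
  have d2 : 0 < d ^+ 2 by rewrite exprn_gt0.
  have : 4 * c * L <= L * d ^+ 2 * L.
    by rewrite ler_wpM2r // -ler_pdivrMr.
  by rewrite !expr2; lra.
rewrite {2}(_ : d * L = d * L / 2 + d * L / 2) ?expRD; last by lra.
by rewrite expr2 ler_pM // divr_ge0 // mulr_ge0 // ltW.
Qed.

End Asymptotics.

Theorem theorem1 (R : realType) (beta gamma : R)
  (p : forall n : nat, {set 'I_n} -> R) :
  0 < beta -> beta < 2^-1 -> 0 < gamma -> gamma < 2^-1 - beta ->
  (forall n (e : {set 'I_n}), e \in Kedges n -> 0 <= p n e <= 1) ->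
  (exists N0 : nat, forall n : nat, (N0 <= n)%N ->
     1 / (n%:R `^ beta) <= alpha_low (p n) /\
     alpha_low (p n) <= alpha_up (p n) /\
     alpha_up (p n) <= Num.max (2^-1) (1 - Num.sqrt (alpha_e (p n) / 2))
                       - 1 / (n%:R `^ gamma)) ->
  exists D : R, 0 < D /\
    exists N : nat, forall n : nat, (N <= n)%N ->
      rg_prob (p n) (fun S => Next_le S (3 * tG S)) >=
        1 - expR (- (D * (ln (n%:R : R)) ^+ 2))
          - rg_prob (p n) (fun S => ~ connectedG S).
Proof.
move=> beta0 beta2 gamma0 gamma2 p01 [N0 hyp].
have d0 : 0 < 2^-1 - gamma by lra.
have [N1 dom] := @powR_dominates_ln R 10 _ (ltr0n R 10) d0.
have [N2 ln3] := @ln_nat_ge R 3.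
exists 2^-1; split; first by rewrite invr_gt0 ltr0n.
exists (maxn 2 (maxn N0 (maxn N1 N2))) => n; rewrite !geq_max.
move=> /and4P[n2 nN0 nN1 nN2]; have [_ [_ le_up]] := hyp n nN0.
have n1 : 1 <= n%:R :> R by rewrite ler1n ltnW.
apply: (rg_prob_Next_le n2 (p01 n) le_up); last 1 first.
- apply: le_trans (dom n nN1) _; rewrite -powR12_sqrt ?ler0n // mul1r -powRN.
  by rewrite -powRD ?(addrC (- gamma)) // pnatr_eq0 -lt0n (ltnW n2) implybT.
- rewrite mul1r invf_le1 ?powR_gt0 ?(lt_le_trans ltr01) //.
  by rewrite -[leLHS](powRr0 (n%:R)) ler_powR // ltW.
- exact: ln3.
Qed.
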